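(* The strong inverse conjecture for the Gowers norm fails when $p=2$ and $k=5$. That is, the following assertion is false: For every $\eta>0$ and every decreasing function $\varepsilon:\mathbb{N}\to\mathbb{R}^+$ there exists a natural number $M$ (depending only on $\eta,\varepsilon$) such that, whenever $G=\mathbb{F}_2^n$ for some $n$ and $f:G\to\mathbb{D}$ satisfies $\|f\|_{U^{6}(G)}\ge\eta$, then, drawing $\vec h=(h_1,\dots,h_M)$ uniformly at random from $G^M$, with probability at least $1/2$ there exist $1\le m\le M$, $P\in\mathrm{Poly}^5(G)$ and a function $F:\mathbb{D}^{\mathbb{F}_2^M}\to\mathbb{C}$ of Lipschitz constant at most $M$ (for the Euclidean metric on $\mathbb{D}^{\mathbb{F}_2^M}$) such that $$\Big|\mathbb{E}_{x\in G} f(x)e(-P(x))\Big|\ge \frac1m \quad\text{and}\quad \mathbb{E}_{x\in G}\Big| e(P(x))-F\big((f(x+a\cdot\vec h))_{a\in\mathbb{F}_2^M}\big)\Big|\le\varepsilon(m).$$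
   Context: $\mathbb{T}=\mathbb{R}/\mathbb{Z}$, $e(\theta)=e^{2\pi i\theta}$, $\mathbb{D}=\{z\in\mathbb{C}:|z|\le1\}$, $\mathbb{E}_{x\in A}=\frac1{|A|}\sum_{x\in A}$ for finite $A$, and $a\cdot\vec h=\sum_i a_ih_i$. For a finite abelian group $G$ and $f:G\to\mathbb{C}$, the Gowers norm $\|f\|_{U^{6}(G)}\ge 0$ is defined by $$\|f\|_{U^{6}(G)}^{64}=\mathbb{E}_{x,h_1,\dots,h_{6}\in G}\prod_{\omega\in\{0,1\}^{6}}\mathcal{C}^{|\omega|}f(x+\omega\cdot\vec h),$$ where $\mathcal{C}$ is complex conjugation and $|\omega|=\sum\omega_i$. $\mathrm{Poly}^5(G)$ is the group of (non-classical) polynomials of degree at most $5$, i.e. functions $P:G\to\mathbb{T}$ with $\partial_{h_1}\cdots\partial_{h_{6}}P=0$ for all $h_1,\dots,h_{6}\in G$, where $\partial_hP(x)=P(x+h)-P(x)$. *)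

(* Defs.v *)
From HB Require Import structures.
From mathcomp Require Import all_boot all_order all_algebra.
From mathcomp Require Import complex.
From mathcomp Require Import all_classical all_reals all_analysis.

Set Implicit Arguments.
Unset Strict Implicit.
Unset Printing Implicit Defensive.

Import Order.TTheory GRing.Theory Num.Theory.
Local Open Scope ring_scope.
Local Open Scope complex_scope.

(* The subgroup Z of R, i.e. the predicate underlying [Num.int]. *)
Definition int_sub (R : realType) : zmodClosed R :=
  GRing.ZmodClosed.clone R (@Num.int_num_subdef R) _.

Definition torus (R : realType) : Type :=
  {ideal_quot (int_sub R)}.
HB.instance Definition _ (R : realType) := Choice.on (torus R).
HB.instance Definition _ (R : realType) := EqQuotient.on (torus R).
HB.instance Definition _ (R : realType) := GRing.Zmodule.on (torus R).
HB.instance Definition _ (R : realType) := ZmodQuotient.on (torus R).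

(* Defined on a representative; [eT_pi] shows the choice is irrelevant. *)
Definition eT (R : realType) (t : torus R) : R[i] :=
  let theta : R := repr t in
  cos (2 * pi * theta) +i* sin (2 * pi * theta).

Lemma eT_pi (R : realType) (theta : R) :
  eT (\pi_(torus R)%qT theta) =
  cos (2 * pi * theta) +i* sin (2 * pi * theta).
Proof.
have perC (f : R -> R) (x : R) (k : int) :
    periodic f (pi *+ 2) -> f (2 * pi * (x + k%:~R)) = f (2 * pi * x).
  move=> pf; have n2pi (n : nat) : 2 * pi * (n%:R : R) = pi *+ 2 *+ n.
    by rewrite -[RHS]mulr_natr -(mulr_natl pi 2).
  case: k => n.
    by rewrite mulrDr -pmulrn n2pi (periodicn pf).
  by rewrite -[LHS](periodicn pf n.+1) -n2pi -mulrDr NegzE mulrNz -pmulrn addrNK.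
rewrite /eT; set t := repr _.
have /intrP[k tk] : t - theta \is a Num.int.
  have := Quotient.idealrBE (int_sub R) t theta.
  by rewrite /t reprK eqxx => ->.
have -> : t = theta + k%:~R by rewrite -tk addrC subrK.
by rewrite !perC //; [exact: sinD2pi | exact: cosD2pi].
Qed.

Definition disk (R : realType) : Type := {z : R[i] | `|z| <= 1}.

Definition avg (R : realType) (A : finType) (F : A -> R[i]) : R[i] :=
  #|A|%:R^-1 * \sum_(x : A) F x.

(* The average below is a nonnegative real, and [n.-root] of such a number is
   its nonnegative real [n]-th root. *)
Definition gowers_norm (R : realType) (k : nat) (G : finZmodType)
    (f : G -> R[i]) : R[i] :=
  (2 ^ k)%N.-root
    (avg (fun xh : G * {ffun 'I_k -> G} =>
       \prod_(w : {ffun 'I_k -> bool})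
         iter (\sum_(i < k) w i)%N Num.conj
              (f (xh.1 + \sum_(i < k) xh.2 i *+ w i)))).

Lemma gowers_normX (R : realType) (k : nat) (G : finZmodType) (f : G -> R[i]) :
  gowers_norm k f ^+ (2 ^ k) =
  avg (fun xh : G * {ffun 'I_k -> G} =>
    \prod_(w : {ffun 'I_k -> bool})
      iter (\sum_(i < k) w i)%N Num.conj
           (f (xh.1 + \sum_(i < k) xh.2 i *+ w i))).
Proof. by rewrite rootCK // expn_gt0. Qed.

Definition fderiv (G T : zmodType) (h : G) (P : G -> T) : G -> T :=
  fun x => P (x + h) - P x.

Definition is_poly (R : realType) (G : zmodType) (d : nat) (P : G -> torus R)
    : Prop :=
  forall (hs : d.+1.-tuple G) (x : G), foldr (@fderiv G (torus R)) P hs x = 0.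

Definition dot (n M : nat) (a : 'rV['F_2]_M) (h : {ffun 'I_M -> 'rV['F_2]_n}) :
    'rV['F_2]_n :=
  \sum_(i < M) a ord0 i *: h i.

(* Functions [I -> disk R] carry the Euclidean metric of C^I. *)
Definition lipschitz_eucl (R : realType) (I : finType) (L : R)
    (F : (I -> disk R) -> R[i]) : Prop :=
  forall u v : I -> disk R,
    `|F u - F v| <= L%:C * sqrtC (\sum_(i : I) `|val (u i) - val (v i)| ^+ 2).

Definition prob (R : realType) (A : finType) (Q : A -> Prop) : R :=
  #|[set x : A | `[< Q x >]]|%:R / #|A|%:R.

(* Main.v *)
(* Write [P] for a sum of many quartic monomials in bits, taken modulo 4, and
   [S], [L] for sums of many quadratic monomials. The counterexample is
     f = i^P (-1)^(B L),   B = second binary digit of S.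
   Here [i^P] is a non-classical quintic phase, and [f] correlates with [i^P] or
   [i^P (-1)^L], so that its U^6 norm is bounded below. On the other hand [f] is
   locally unchanged under [P -> P + 2 L, S -> S + 2] and only depends on the
   parity of [L], whereas a quintic polynomial that is determined by [f] and
   correlates with it cannot satisfy both invariances. Concretely, for most
   [x] and [h] one finds 8 directions such that at the vertex [b] of the
   cube they span, and simultaneously at all its translates by [a . h], the
   values of [P, S, L] have moved by [s Y, s, t], where
     s = b1 b2 + b3 b4,   t = b5 b6 + b7 b8
   and [Y] has the parity of [L]. The values of [f] do not distinguish
   [(s, 2)] from [(s, 0)] nor [(2, 0)] from [(0, 0)], and they are opposite at
   [(2, 1)] and [(0, 1)]. A quintic [Q] that is almost a function of these
   values then satisfies [Q (2, 1) = Q (0, 1)], as one sees by comparing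
   its vanishing alternating sums over two 6-dimensional faces. Hence [f e(-Q)]
   takes nearly opposite values at two points, each of which is almost uniformly
   distributed, and its average is nearly 0. *)
Require Import Defs.
From HB Require Import structures.
From mathcomp Require Import all_boot all_order all_algebra.
From mathcomp Require Import complex.
From mathcomp Require Import all_classical all_reals all_analysis.
From mathcomp Require Import ring lra zify.

Set Implicit Arguments.
Unset Strict Implicit.
Unset Printing Implicit Defensive.

Import Order.TTheory GRing.Theory Num.Theory.
Local Open Scope ring_scope.
Local Open Scope complex_scope.

(** * Averages over finite types *)

Section Average.
Variable R : realType.
Implicit Types A B : finType.

Lemma eq_avg A (F G : A -> R[i]) : F =1 G -> avg F = avg G.
Proof. by move=> FG; rewrite /avg (eq_bigr _ (fun x _ => FG x)). Qed.

Lemma avgD A (F G : A -> R[i]) : avg (fun x => F x + G x) = avg F + avg G.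
Proof. by rewrite /avg big_split mulrDr. Qed.

Lemma avgZ A c (F : A -> R[i]) : avg (fun x => c * F x) = c * avg F.
Proof. by rewrite /avg -mulr_sumr mulrCA. Qed.

Lemma avgB A (F G : A -> R[i]) : avg (fun x => F x - G x) = avg F - avg G.
Proof. by rewrite /avg big_split sumrN mulrDr mulrN. Qed.

Lemma avg_sum A (I : finType) (F : I -> A -> R[i]) :
  avg (fun x => \sum_i F i x) = \sum_i avg (F i).
Proof. by rewrite /avg exchange_big mulr_sumr. Qed.

Lemma ler_norm_avg A (F : A -> R[i]) : `|avg F| <= avg (fun x => `|F x|).
Proof.
rewrite /avg normrM normfV normr_nat ler_wpM2l ?invr_ge0 ?ler0n //.
exact: ler_norm_sum.
Qed.

Lemma ler_avg A (F G : A -> R[i]) :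
  (forall x, F x <= G x) -> avg F <= avg G.
Proof.
by move=> FG; rewrite /avg ler_wpM2l ?invr_ge0 ?ler0n // ler_sum.
Qed.

Lemma avg_ge0 A (F : A -> R[i]) : (forall x, 0 <= F x) -> 0 <= avg F.
Proof. by move=> F0; rewrite mulr_ge0 ?invr_ge0 ?ler0n // sumr_ge0. Qed.

Lemma avg_const A (c : R[i]) : (0 < #|A|)%N -> avg (fun _ : A => c) = c.
Proof.
move=> A0; rewrite /avg sumr_const -[c *+ _]mulr_natl mulKf //.
by rewrite pnatr_eq0 -lt0n.
Qed.

Lemma avg_pair A B (F : A -> B -> R[i]) :
  avg (fun ab : A * B => F ab.1 ab.2) = avg (fun a => avg (F a)).
Proof.
rewrite /avg -(pair_bigA _ F) -mulr_sumr mulrA card_prod natrM invfM.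
by [].
Qed.

Lemma avg_exchange A B (F : A -> B -> R[i]) :
  avg (fun a => avg (F a)) = avg (fun b => avg (F^~ b)).
Proof. by rewrite /avg -!mulr_sumr exchange_big mulrCA. Qed.

Lemma avg_reindex A B (h : A -> B) (F : B -> R[i]) :
  bijective h -> avg F = avg (F \o h).
Proof.
move=> hb; rewrite /avg (bij_eq_card hb) (reindex h) //.
exact: onW_bij.
Qed.

Lemma avg_le_bound A (F : A -> R[i]) C :
  (forall x, `|F x| <= C) -> 0 <= C -> `|avg F| <= C.
Proof.
move=> FC C0; apply: le_trans (ler_norm_avg F) _.
apply: le_trans (ler_avg FC) _.
rewrite /avg sumr_const -[C *+ _]mulr_natl.
have [->|A0] := eqVneq (#|A|)%N 0%N; first by rewrite !mul0r mulr0.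
by rewrite mulKf // pnatr_eq0.
Qed.

End Average.

(** * Planting a letter at a random position of a random word *)

Section Planting.
Variables (R : realType) (I S : finType).

Definition upd (w : {ffun I -> S}) (p : I) (s : S) : {ffun I -> S} :=
  [ffun i => if i == p then s else w i].

(** Exchanging [s] with the letter of [w] at [p] is an involution on the pairs [(w, s)]. *)
Lemma sum_upd (psi : {ffun I -> S} -> R[i]) (p : I) :
  \sum_w \sum_s psi (upd w p s) = #|S|%:R * \sum_w psi w.
Proof.
rewrite (pair_bigA _ (fun w s => psi (upd w p s))) /=.
pose h (x : {ffun I -> S} * S) := (upd x.1 p x.2, x.1 p).
have hK : involutive h.
  move=> [w s]; rewrite /h /= ffunE eqxx; congr pair.
  by apply/ffunP=> i; rewrite !ffunE; case: eqP => [->|].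
rewrite (reindex h) /=; last by apply: onW_bij; exists h.
rewrite (eq_bigr (fun x => psi x.1)); last first.
  move=> [w s] _ /=; congr psi.
  by apply/ffunP=> i; rewrite !ffunE; case: eqP => [->|].
rewrite -(pair_bigA _ (fun w (s : S) => psi w)) /= mulr_sumr.
by apply: eq_bigr => w _; rewrite sumr_const -[LHS]mulr_natl.
Qed.

(* Overwriting one uniformly random position by a fixed letter barely changes
   the uniform distribution: its density relative to it is the normalised
   number of occurrences of the letter, which concentrates. *)
Lemma avg_plant (phi : {ffun I -> S} -> R[i]) (C : R[i]) (D : nat) (c : S) :
  (0 < D)%N -> #|I| = (#|S| * D ^ 2)%N -> (forall w, `|phi w| <= C) ->
  `|avg phi - avg (fun wp : {ffun I -> S} * I => phi (upd wp.1 wp.2 c))|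
    <= C / D%:R.
Proof.
move=> D0 cI phiC.
have S0 : (0 < #|S|)%N by apply/card_gt0P; exists c.
have I0 : (0 < #|I|)%N by rewrite cI muln_gt0 S0 expn_gt0 D0.
have nzS : #|S|%:R != 0 :> R[i] by rewrite pnatr_eq0 -lt0n.
have nzI : #|I|%:R != 0 :> R[i] by rewrite pnatr_eq0 -lt0n.
have nzD : D%:R != 0 :> R[i] by rewrite pnatr_eq0 -lt0n.
have C0 : 0 <= C by apply: le_trans (phiC [ffun=> c]).
(* [g] has mean zero over the alphabet. For its average [t] over the positions of a word, [1 - t] is
   the density of the planted word relative to the uniform one. *)
pose g s : R[i] := 1 - #|S|%:R * (s == c)%:R.
have gR s : g s \is Num.real by rewrite rpredB ?rpredM ?rpred1 ?rpred_nat.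
have sg : \sum_s g s = 0.
  rewrite big_split /= sumr_const sumrN -mulr_sumr (bigD1 c) //= eqxx big1 ?addr0.
    by rewrite mulr1 subrr.
  by move=> s /negPf ->.
have sg2 : \sum_s g s ^+ 2 <= #|S|%:R ^+ 2.
  have -> : \sum_s g s ^+ 2 = #|S|%:R * (#|S|%:R - 1).
    rewrite (eq_bigr (fun s => 1 + (#|S|%:R ^+ 2 - 2 * #|S|%:R) * (s == c)%:R)).
      rewrite big_split /= sumr_const -mulr_sumr (bigD1 c) //= eqxx big1 ?addr0.
        by rewrite -[1 *+ _]/(#|S|%:R) mulr1; ring.
      by move=> s /negPf ->.
    by move=> s _; rewrite /g; case: (s == c) => /=; ring.
  by rewrite expr2 ler_wpM2l ?ler0n // gerBl ler01.
have gw (psi : S -> R[i]) p : avg (fun w : {ffun I -> S} => psi (w p)) =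
    #|S|%:R^-1 * \sum_s psi s.
  rewrite /avg -[X in _ * X = _](mulKf nzS) -(sum_upd _ p).
  under eq_bigr do under eq_bigr do rewrite ffunE eqxx.
  rewrite sumr_const -[X in _ * (_ * X)]mulr_natl mulrCA; congr (_ * _).
  by rewrite mulKf // pnatr_eq0 -lt0n; apply/card_gt0P; exists [ffun=> c].
have gg p p' : p != p' ->
    avg (fun w : {ffun I -> S} => g (w p) * g (w p')) = 0.
  move=> pp'; rewrite /avg -[X in _ * X = _](mulKf nzS) -(sum_upd _ p).
  rewrite big1 ?mulr0 // => w _.
  under eq_bigr do rewrite !ffunE eqxx eq_sym (negPf pp').
  by rewrite -mulr_suml sg mul0r.
pose t (w : {ffun I -> S}) := #|I|%:R^-1 * \sum_p g (w p).
have tR w : t w \is Num.real.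
  by rewrite rpredM ?rpredV ?rpred_nat // rpred_sum.
(* Terms with [p != p'] vanish by independence, so this second moment is at most [#|S| / #|I|],
   which the choice of [#|I|] makes [1 / D ^ 2]. *)
have t2 : avg (fun w => t w ^+ 2) <= (D%:R ^+ 2)^-1.
  have -> : avg (fun w => t w ^+ 2) =
      #|I|%:R^-1 * (#|S|%:R^-1 * \sum_s g s ^+ 2).
    rewrite (@eq_avg _ _ _ (fun w : {ffun I -> S} =>
        #|I|%:R^-2 * \sum_p \sum_p' g (w p) * g (w p'))); last first.
      move=> w; rewrite /t exprMn exprVn; congr (_ * _).
      rewrite expr2 mulr_suml.
      by apply: eq_bigr => p _; rewrite mulr_sumr.
    rewrite avgZ avg_sum (eq_bigr (fun _ => #|S|%:R^-1 * \sum_s g s ^+ 2)).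
      rewrite sumr_const -[X in _ * X = _]mulr_natl [LHS]mulrA.
      by congr (_ * _); rewrite expr2 invfM -mulrA mulVf ?mulr1.
    move=> p _; rewrite avg_sum (bigD1 p) //= big1 ?addr0.
      by rewrite -(gw (fun s => g s ^+ 2) p); apply: eq_avg => w; rewrite expr2.
    by move=> p'; rewrite eq_sym => /gg.
  have -> : (D%:R ^+ 2)^-1 = #|I|%:R^-1 * (#|S|%:R^-1 * #|S|%:R ^+ 2) :> R[i].
    by rewrite cI natrM natrX; field; rewrite nzS.
  by rewrite !ler_wpM2l ?invr_ge0 ?ler0n.
have -> : avg (fun wp : {ffun I -> S} * I => phi (upd wp.1 wp.2 c)) =
    avg (fun w => phi w * (1 - t w)).
  rewrite (avg_pair (fun w p => phi (upd w p c))) avg_exchange.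
  have -> : (fun w => phi w * (1 - t w)) = (fun w => #|I|%:R^-1 *
      \sum_p phi w * (#|S|%:R * (w p == c)%:R)).
    apply/funext => w; rewrite -mulr_sumr mulrCA; congr (_ * _).
    rewrite /t big_split /= sumr_const -[1 *+ _]/(#|I|%:R) sumrN mulrBr mulVf //.
    by rewrite opprB addrC subrK.
  rewrite [RHS]avgZ avg_sum /avg; congr (_ * _); apply: eq_bigr => p _.
  congr (_ * _).
  transitivity (\sum_w \sum_s phi (upd w p s) * ((upd w p s) p == c)%:R).
    apply: eq_bigr => w _; rewrite (bigD1 c) //= ffunE !eqxx mulr1 big1 ?addr0 //.
    by move=> s /negPf sc; rewrite ffunE eqxx sc mulr0.
  rewrite (sum_upd (fun w => phi w * (w p == c)%:R)) mulr_sumr.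
  by apply: eq_bigr => w _; rewrite mulrCA.
rewrite -avgB (eq_avg (G := fun w => phi w * t w)); last by move=> w; ring.
apply: le_trans (ler_norm_avg _) _.
(* AM-GM: 2 |t| <= D t^2 + 1 / D *)
have amgm w : `|phi w * t w| <= C * (2^-1 * (D%:R * t w ^+ 2 + D%:R^-1)).
  rewrite normrM ler_pM //.
  have -> : t w ^+ 2 = `|t w| ^+ 2 by rewrite real_normK.
  have -> : 2^-1 * (D%:R * `|t w| ^+ 2 + D%:R^-1) =
     `|t w| + (2 * D%:R)^-1 * (D%:R * `|t w| - 1) ^+ 2.
    by field.
  rewrite lerDl; apply: mulr_ge0; first by rewrite invr_ge0 -natrM ler0n.
  exact: real_exprn_even_ge0.
apply: le_trans (ler_avg amgm) _.
rewrite avgZ avgZ avgD avgZ avg_const; last first.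
  by apply/card_gt0P; exists [ffun=> c].
rewrite ler_wpM2l //.
apply: (@le_trans _ _ (2^-1 * (D%:R * (D%:R ^+ 2)^-1 + D%:R^-1))).
  by rewrite ler_wpM2l ?invr_ge0 ?ler0n // lerD2r ler_wpM2l ?ler0n.
by have -> : 2^-1 * (D%:R * (D%:R ^+ 2)^-1 + D%:R^-1) = D%:R^-1 :> R[i] by field.
Qed.

End Planting.

(** * The character of R/Z *)

Section Torus.
Variable R : realType.

Lemma eT_piD (a b : R) :
  cos (2 * pi * (a + b)) +i* sin (2 * pi * (a + b)) =
  (cos (2 * pi * a) +i* sin (2 * pi * a)) *
  (cos (2 * pi * b) +i* sin (2 * pi * b)) :> R[i].
Proof.
rewrite mulrDr cosD sinD; apply/eqP; rewrite eq_complex /=.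
by rewrite eqxx /= addrC.
Qed.

Lemma eTD (s t : torus R) : eT (s + t) = eT s * eT t.
Proof.
rewrite -[s]reprK -[t]reprK -(raddfD (\pi_(torus R)%qT)) !eT_pi.
exact: eT_piD.
Qed.

Lemma eT0 : eT (0 : torus R) = 1.
Proof.
by rewrite -(raddf0 (\pi_(torus R)%qT)) eT_pi mulr0 cos0 sin0.
Qed.

Lemma norm_eT (t : torus R) : `|eT t| = 1.
Proof. by rewrite /eT normc_def /= cos2Dsin2 sqrtr1. Qed.

Lemma dist_eT (s t : torus R) : `|eT s - eT t| = `|eT (s - t) - 1|.
Proof.
rewrite -[RHS]mulr1 -{2}(norm_eT t) -normrM mulrBl mul1r -eTD subrK //.
Qed.

End Torus.

(** * Alternating sums over cubes *)

Section TwoCubes.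
Variable Z : zmodType.

Definition dd (phi : bool -> bool -> Z) : Z :=
  phi true true - phi true false - (phi false true - phi false false).

(** This is why bits occur in pairs: along [a && b] a second derivative becomes a first difference,
    so a sixfold derivative sees a third-order difference in [s] and [t]. *)
Lemma dd_and (phi : bool -> Z) :
  dd (fun a b => phi (a && b)) = phi true - phi false.
Proof. by rewrite /dd /= subrr subr0. Qed.

Lemma fderiv2 (G : zmodType) (k l : G) (P : G -> Z) (x : G) :
  fderiv k (fderiv l P) x = dd (fun a b => P (x + k *+ a + l *+ b)).
Proof. by rewrite /dd /fderiv !mulr0n !mulr1n !addr0. Qed.

Variables (T : numDomainType) (N : Z -> T).
Hypotheses (ND : forall s t, N (s + t) <= N s + N t)
  (NN : forall s, N (- s) = N s).

Lemma dd_close (phi psi : bool -> bool -> Z) (e : T) :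
  (forall a b, N (phi a b - psi a b) <= e) -> N (dd phi - dd psi) <= e *+ 4.
Proof.
move=> H; rewrite /dd.
have -> : phi true true - phi true false - (phi false true - phi false false)
  - (psi true true - psi true false - (psi false true - psi false false)) =
  (phi true true - psi true true) - (phi true false - psi true false)
  - ((phi false true - psi false true) - (phi false false - psi false false)).
  by rewrite !opprD !opprK !addrA (ACl (1*5*2*6*3*7*4*8)).
have sub s t : N (s - t) <= N s + N t by rewrite -[N t]NN.
rewrite -[4%N]/(2 + 2)%N mulrnDr; apply: le_trans (sub _ _) _.
by apply: lerD; rewrite mulr2n; apply: le_trans (sub _ _) _; apply: lerD.
Qed.

(* [s = b1 b2 + b3 b4] and [t = b5 b6 + b7 b8]. The first cube gives the second
   difference in [s] and first difference in [t] of [r] at the origin, the second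
   one the first difference in [s] and second difference in [t]; once the
   identifications [(s, 2) ~ (s, 0)] and [(2, 0) ~ (0, 0)] are made, they differ
   by [r 2 1 - r 0 1]. *)
Lemma two_cubes
    (q : bool -> bool -> bool -> bool -> bool -> bool -> bool -> bool -> Z)
    (r : nat -> nat -> Z) (e : T) :
  dd (fun b1 b2 => dd (fun b3 b4 => dd (fun b5 b6 =>
    q b1 b2 b3 b4 b5 b6 false false))) = 0 ->
  dd (fun b1 b2 => dd (fun b5 b6 => dd (fun b7 b8 =>
    q b1 b2 false false b5 b6 b7 b8))) = 0 ->
  r 0 2 = r 0 0 -> r 1 2 = r 1 0 -> r 2 0 = r 0 0 ->
  (forall b1 b2 b3 b4 b5 b6 b7 b8,
    N (q b1 b2 b3 b4 b5 b6 b7 b8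
       - r ((b1 && b2) + (b3 && b4))%N ((b5 && b6) + (b7 && b8))%N) <= e) ->
  N (r 2 1 - r 0 1) <= e *+ 128.
Proof.
move=> q1 q2 r02 r12 r20 qr.
have r1 : N (0 - (r 2 1 - r 0 0 - (r 1 1 - r 1 0)
    - (r 1 1 - r 1 0 - (r 0 1 - r 0 0)))) <= e *+ 64.
  have -> : r 2 1 - r 0 0 - (r 1 1 - r 1 0)
      - (r 1 1 - r 1 0 - (r 0 1 - r 0 0)) =
      dd (fun b1 b2 => dd (fun b3 b4 => dd (fun b5 b6 =>
        r ((b1 && b2) + (b3 && b4))%N ((b5 && b6) + 0)%N))).
    rewrite (dd_and (fun b => dd (fun b3 b4 => dd (fun b5 b6 =>
        r (b + (b3 && b4))%N ((b5 && b6) + 0)%N)))).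
    rewrite !(dd_and (fun b => dd (fun b5 b6 =>
        r (_ + b)%N ((b5 && b6) + 0)%N))).
    rewrite !(dd_and (fun b => r _ (b + 0)%N)).
    by rewrite -[r (true + true)%N (false + 0)%N]/(r 2%N 0%N) r20.
  rewrite -q1 -[64%N]/(4 * (4 * 4))%N !mulrnA.
  by do 3!apply: dd_close => ? ?; rewrite -[0%N]/(false && false + 0)%N.
have r2 : N (0 - (r 1 2 - r 1 1 - (r 1 1 - r 1 0)
    - (r 0 2 - r 0 1 - (r 0 1 - r 0 0)))) <= e *+ 64.
  have -> : r 1 2 - r 1 1 - (r 1 1 - r 1 0)
      - (r 0 2 - r 0 1 - (r 0 1 - r 0 0)) =
      dd (fun b1 b2 => dd (fun b5 b6 => dd (fun b7 b8 =>
        r ((b1 && b2) + 0)%N ((b5 && b6) + (b7 && b8))%N))).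
    rewrite (dd_and (fun b => dd (fun b5 b6 => dd (fun b7 b8 =>
        r (b + 0)%N ((b5 && b6) + (b7 && b8))%N)))).
    rewrite !(dd_and (fun b => dd (fun b7 b8 =>
        r (_ + 0)%N (b + (b7 && b8))%N))).
    by rewrite !(dd_and (fun b => r _ (_ + b)%N)).
  rewrite -q2 -[64%N]/(4 * (4 * 4))%N !mulrnA.
  by do 3!apply: dd_close => ? ?.
have -> : r 2 1 - r 0 1 =
   (0 - (r 1 2 - r 1 1 - (r 1 1 - r 1 0)
    - (r 0 2 - r 0 1 - (r 0 1 - r 0 0))))
   - (0 - (r 2 1 - r 0 0 - (r 1 1 - r 1 0)
    - (r 1 1 - r 1 0 - (r 0 1 - r 0 0)))).
  rewrite r12 r02.
  have -> : r 1 0 - r 1 1 = - (r 1 1 - r 1 0) by rewrite opprB.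
  have -> : r 0 0 - r 0 1 = - (r 0 1 - r 0 0) by rewrite opprB.
  have -> : r 2 1 - r 0 1 = (r 2 1 - r 0 0) - (r 0 1 - r 0 0).
    by rewrite opprB addrA subrK.
  move: (r 2 1 - r 0 0) (r 1 1 - r 1 0) (r 0 1 - r 0 0) => w u v.
  rewrite !sub0r !opprD !opprK !addrA.
  by rewrite [RHS](ACl (5*4*((1*6)*(2*7)*(8*3)))) /= !subrr !addr0.
rewrite -[128%N]/(64 + 64)%N mulrnDr.
by apply: le_trans (ND _ _) _; rewrite [N (- _)]NN lerD.
Qed.

End TwoCubes.

(** * Splitting off the first direction of a tuple *)

Section FinfunCons.
Variables (T : Type) (n : nat).

Definition fcons (t : T) (h : {ffun 'I_n -> T}) : {ffun 'I_n.+1 -> T} :=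
  [ffun i => oapp h t (unlift ord0 i)].

Definition ftail (h : {ffun 'I_n.+1 -> T}) : {ffun 'I_n -> T} :=
  [ffun i => h (lift ord0 i)].

Lemma fcons0 t h : fcons t h ord0 = t.
Proof. by rewrite ffunE unlift_none. Qed.

Lemma fconsS t h i : fcons t h (lift ord0 i) = h i.
Proof. by rewrite ffunE liftK. Qed.

Lemma fconsK t h : ftail (fcons t h) = h.
Proof. by apply/ffunP=> i; rewrite ffunE fconsS. Qed.

Lemma fcons_eta (h : {ffun 'I_n.+1 -> T}) : fcons (h ord0) (ftail h) = h.
Proof.
by apply/ffunP=> i; rewrite ffunE; case: unliftP => [j|] -> //=; rewrite ffunE.
Qed.

Lemma fcons_bij : bijective (fun th => fcons th.1 th.2).
Proof.
exists (fun h : {ffun 'I_n.+1 -> T} => (h ord0, ftail h)) => [[t h]|h].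
  by rewrite fcons0 fconsK.
exact: fcons_eta.
Qed.

End FinfunCons.

(** * Gowers averages and their monotonicity *)

Section Gowers.
Variables (R : realType) (G : finZmodType).
Implicit Types F : G -> R[i].

Definition gprod k F (x : G) (h : {ffun 'I_k -> G}) : R[i] :=
  \prod_(w : {ffun 'I_k -> bool})
    iter (\sum_(i < k) w i)%N Num.conj (F (x + \sum_(i < k) h i *+ w i)).

Lemma iter_conjM n (a b : R[i]) :
  iter n Num.conj (a * b) = iter n Num.conj a * iter n Num.conj b.
Proof. by elim: n => //= n ->; rewrite rmorphM. Qed.

Lemma gprodM k F1 F2 x (h : {ffun 'I_k -> G}) :
  gprod (fun y => F1 y * F2 y) x h = gprod F1 x h * gprod F2 x h.
Proof. by rewrite -big_split; apply: eq_bigr => w _; apply: iter_conjM. Qed.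

Lemma eq_gprod k F1 F2 x (h : {ffun 'I_k -> G}) :
  F1 =1 F2 -> gprod F1 x h = gprod F2 x h.
Proof. by move=> F12; apply: eq_bigr => w _; rewrite F12. Qed.

Lemma gprod_conj k F a x (h : {ffun 'I_k -> G}) :
  gprod (fun y => Num.conj (F (y + a))) x h = Num.conj (gprod F (x + a) h).
Proof.
by rewrite rmorph_prod; apply: eq_bigr => w _; rewrite -iterSr addrAC.
Qed.

Lemma gprod0 F x (h : {ffun 'I_0 -> G}) : gprod F x h = F x.
Proof.
rewrite /gprod (bigD1 [ffun=> false]) //= !big_ord0 addr0 big1 ?mulr1 //.
by move=> w /eqP[]; apply/ffunP=> -[].
Qed.

(** Pairing each vertex with its neighbour in the direction [h ord0] turns the product over a cube
    into that of a multiplicative derivative over a face. *)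
Lemma gprodS k F x (h : {ffun 'I_k.+1 -> G}) :
  gprod F x h =
  gprod (fun y => F y * Num.conj (F (y + h ord0))) x (ftail h).
Proof.
rewrite gprodM gprod_conj /gprod (reindex _ (onW_bij _ (fcons_bij _ _))) /=.
rewrite -(pair_bigA _ (fun b (w : {ffun 'I_k -> bool}) =>
    iter (\sum_i fcons b w i)%N Num.conj
    (F (x + \sum_i h i *+ fcons b w i)))) /= big_bool [RHS]mulrC.
have sumS b (w : {ffun 'I_k -> bool}) :
    (\sum_i fcons b w i = b + \sum_i w i)%N.
  rewrite big_ord_recl fcons0; congr (_ + _)%N.
  by apply: eq_bigr => i _; rewrite fconsS.
have sumG b (w : {ffun 'I_k -> bool}) :
    \sum_i h i *+ fcons b w i = h ord0 *+ b + \sum_i ftail h i *+ w i.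
  rewrite big_ord_recl fcons0; congr (_ + _).
  by apply: eq_bigr => i _; rewrite fconsS ffunE.
rewrite rmorph_prod; congr (_ * _); apply: eq_bigr => w _.
  by rewrite sumS sumG mulr1n addrA.
by rewrite sumS sumG add0n mulr0n add0r.
Qed.

Lemma norm_avg_sqr (A : finType) (a : A -> R[i]) : (0 < #|A|)%N ->
  `|avg a| ^+ 2 <= avg (fun x => `|a x| ^+ 2).
Proof.
move=> A0; have := @avg_ge0 _ _ (fun x => `|a x - avg a| ^+ 2).
move=> /(_ (fun x => exprn_ge0 _ (normr_ge0 _))).
have -> : avg (fun x => `|a x - avg a| ^+ 2) =
    avg (fun x => `|a x| ^+ 2) - `|avg a| ^+ 2.
  rewrite (eq_avg (G := fun x => (`|a x| ^+ 2 - Num.conj (avg a) * a x)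
      - (avg a * Num.conj (a x) - `|avg a| ^+ 2))); last first.
    by move=> x; rewrite !normCK rmorphB /=; ring.
  rewrite !avgB !avgZ avg_const //.
  have -> : avg (fun x => Num.conj (a x)) = Num.conj (avg a).
    by rewrite /avg rmorphM rmorph_sum fmorphV rmorph_nat.
  by rewrite -expr2 [`|avg a| ^+ 2]normCK; ring.
by rewrite subr_ge0.
Qed.

(** For uniform [x] and first direction [t] the points [x] and [x + t] are independent, so the
    average over them factors into a mean and its conjugate. *)
Lemma avg_gprodS k F :
  avg (fun xh : G * {ffun 'I_k.+1 -> G} => gprod F xh.1 xh.2) =
  avg (fun h : {ffun 'I_k -> G} => `|avg (fun x => gprod F x h)| ^+ 2).
Proof.
rewrite (avg_pair (fun x h => gprod F x h)).
transitivity (avg (fun x => avg (fun h : {ffun 'I_k -> G} =>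
    gprod F x h * Num.conj (avg (fun y => gprod F y h))))).
  apply: eq_avg => x; rewrite (avg_reindex _ (fcons_bij _ _)) /=.
  rewrite (eq_avg (G := fun th => gprod F x th.2 *
      Num.conj (gprod F (x + th.1) th.2))); last first.
    by move=> [t h]; rewrite /= gprodS fcons0 fconsK gprodM gprod_conj.
  rewrite (avg_pair (fun t h => gprod F x h * Num.conj (gprod F (x + t) h))).
  rewrite avg_exchange; apply: eq_avg => h; rewrite avgZ; congr (_ * _).
  have bx : bijective (+%R x).
    by exists (+%R (- x)) => y; rewrite ?addKr ?addNKr.
  rewrite [in RHS](avg_reindex _ bx) /=.
  by rewrite /avg rmorphM rmorph_sum fmorphV rmorph_nat.
rewrite avg_exchange; apply: eq_avg => h.
rewrite normCK mulrC -avgZ; apply: eq_avg => x; exact: mulrC.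
Qed.

(** By Cauchy-Schwarz in the directions, each new direction at least squares the absolute value of
    the average. The induction starts from the cube of dimension 0, where the average is the mean of
    [F]. *)
Lemma avg_gprod_ge k F :
  `|avg F| ^+ (2 ^ k.+1) <=
  avg (fun xh : G * {ffun 'I_k.+1 -> G} => gprod F xh.1 xh.2).
Proof.
have c0 j : (0 < #|{ffun 'I_j -> G}|)%N.
  by apply/card_gt0P; exists [ffun=> 0].
have step j : `|avg (fun xh : G * {ffun 'I_j -> G} => gprod F xh.1 xh.2)| ^+ 2
    <= avg (fun xh : G * {ffun 'I_j.+1 -> G} => gprod F xh.1 xh.2).
  rewrite avg_gprodS (avg_pair (fun x h => gprod F x h)) avg_exchange.
  exact: norm_avg_sqr.
elim: k => [|k IH].
  apply: le_trans (step 0).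
  rewrite (avg_pair (fun x h => gprod F x h)).
  rewrite [X in _ <= `|X| ^+ _](eq_avg (G := F)) // => x.
  by rewrite (eq_avg (G := fun=> F x)) ?avg_const // => h; rewrite gprod0.
rewrite expnSr exprM; apply: le_trans (step k.+1).
apply: lerXn2r; rewrite ?nnegrE ?exprn_ge0 //.
by rewrite [leRHS]ger0_norm // (le_trans _ IH) ?exprn_ge0.
Qed.

End Gowers.

(** * Weights of functions with values in Z/4 *)

Section Weights.
Variable G : zmodType.
Implicit Types f g : G -> 'Z_4.

(* [wt n.+2 f] says that [f] is a combination modulo 4 of products of at most [n]
   lifts [x |-> |x_j|] of coordinates to {0, 1} and of doubles of products of at
   most [n.+1] of them. *)
Fixpoint wt n f : Prop :=
  if n is m.+1 then
    (forall h, wt m (fderiv h f)) /\ (m = 0 -> forall x, f x *+ 2 = 0)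
  else forall x, f x = 0.

Lemma eq_wt n f g : f =1 g -> wt n f -> wt n g.
Proof.
elim: n f g => [|n IH] f g fg /=; first by move=> f0 x; rewrite -fg.
move=> [fn f2]; split=> [h|n0 x]; last by rewrite -fg f2.
by apply: IH (fn h) => x; rewrite /fderiv !fg.
Qed.

Lemma wtD n f g : wt n f -> wt n g -> wt n (fun x => f x + g x).
Proof.
elim: n f g => [|n IH] f g /=; first by move=> f0 g0 x; rewrite f0 g0 addr0.
move=> [fn f2] [gn g2]; split=> [h|n0 x]; last by rewrite mulrnDl f2 ?g2 ?addr0.
by apply: eq_wt (IH _ _ (fn h) (gn h)) => x; rewrite /fderiv opprD addrACA.
Qed.

Lemma wt0 n : wt n (fun=> 0).
Proof.
elim: n => [|n IH] //=; split=> [h|_ _]; last by rewrite mul0rn.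
by apply: eq_wt IH => x; rewrite /fderiv subrr.
Qed.

Lemma wtN n f : wt n f -> wt n (fun x => - f x).
Proof.
elim: n f => [|n IH] f /=; first by move=> f0 x; rewrite f0 oppr0.
move=> [fn f2]; split=> [h|n0 x]; last by rewrite mulNrn f2 ?oppr0.
by apply: eq_wt (IH _ (fn h)) => x; rewrite /fderiv opprB opprK addrC.
Qed.

Lemma wt_sum n (I : Type) (r : seq I) (P : pred I) (F : I -> G -> 'Z_4) :
  (forall i, wt n (F i)) -> wt n (fun x => \sum_(i <- r | P i) F i x).
Proof.
move=> Fn; elim: r => [|i r IH].
  by apply: eq_wt (wt0 n) => x; rewrite big_nil.
have [Pi|/negPf Pi] := boolP (P i).
  by apply: eq_wt (wtD (Fn i) IH) => x; rewrite big_cons Pi.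
by apply: eq_wt IH => x; rewrite big_cons Pi.
Qed.

Lemma wtS n f : wt n f -> wt n.+1 f.
Proof.
elim: n f => [|n IH] f.
  by move=> f0; split=> [h x|_ x]; rewrite /fderiv !f0 ?subrr ?mul0rn.
by move=> [fn f2]; split=> [h|//]; apply: IH (fn h).
Qed.

Lemma wt_leq m n f : (m <= n)%N -> wt m f -> wt n f.
Proof. by move=> /subnK <-; elim: (n - m)%N => // k IH /IH /wtS. Qed.

Lemma Z4_mul_even (a b : 'Z_4) : a *+ 2 = 0 -> b *+ 2 = 0 -> a * b = 0.
Proof.
case: a b => [[|[|[|[|a]]]] lta] // [[|[|[|[|b]]]] ltb] //;
  move=> /(congr1 val) // a2 /(congr1 val) // b2; exact: val_inj.
Qed.

(** By the Leibniz rule a derivative of [f * g] is a sum of products of smaller total weight. In the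
    base cases, a function of weight 1 is a constant 0 or 2: its derivatives vanish, and the product
    of two such functions is 0 modulo 4. *)
Lemma wtM m n f g : wt m.+1 f -> wt n.+1 g -> wt (m + n) (fun x => f x * g x).
Proof.
have fderivM (h : G) (u v : G -> 'Z_4) x : fderiv h (fun x => u x * v x) x =
    u x * fderiv h v x + (fderiv h u x * v x + fderiv h u x * fderiv h v x).
  by rewrite /fderiv; ring.
have [k] := ubnP (m + n)%N; elim: k => // k IH in m n f g * => /ltnSE le_k fm gn.
case: m => [|m] in fm le_k *; case: n => [|n] in gn le_k *.
- by move=> x; apply: Z4_mul_even; [apply: fm.2|apply: gn.2].
- split=> [h|_ x]; last by rewrite -mulrnAl fm.2 ?mul0r.
  have := IH 0 n _ _ le_k fm (gn.1 h).
  by apply: eq_wt => x; rewrite fderivM fm.1 !mul0r !addr0.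
- rewrite addn0 in le_k *; split=> [h|_ x]; last by rewrite -mulrnAr gn.2 ?mulr0.
  have := IH m 0 _ _; rewrite addn0 => /(_ _ _ le_k (fm.1 h) gn).
  by apply: eq_wt => x; rewrite fderivM gn.1 !mulr0 addr0 add0r.
rewrite addSn in le_k *; split=> [h|]; last by rewrite addnS.
apply: (eq_wt (fun x => esym (fderivM h f g x))).
have fh := fm.1 h; have gh := gn.1 h.
apply: wtD; last apply: wtD.
- rewrite addnS -addSn; apply: IH fm gh; move: le_k; lia.
- by apply: IH fh gn; move: le_k; lia.
- apply: (@wt_leq (m + n)); first lia.
  by apply: IH fh gh; move: le_k; lia.
Qed.

End Weights.

(** * The counterexample and its planted blocks *)

Section Construction.
Variables (R : realType) (M NA NB : nat).

(* Coordinates: slot [s] of block [p] carries two bits [(s, false)], [(s, true)];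
   the blocks indexed by 'I_NB carry moreover bits [(j, false)], [(j, true)] for
   [j <= M]. *)
Definition cell : finType :=
  ('I_NA * (bool * bool) + 'I_NB * (bool * bool + 'I_M.+1 * bool))%type.

Implicit Types (xi : cell -> 'F_2).

Definition bit2 (a b : 'F_2) : nat := (a * b)%N.

Definition Lsum xi : nat :=
  \sum_p \sum_s bit2 (xi (inl (p, (s, false)))) (xi (inl (p, (s, true)))).

Definition Rblock xi (q : 'I_NB) : nat :=
  \sum_s bit2 (xi (inr (q, inl (s, false)))) (xi (inr (q, inl (s, true)))).

Definition Yblock xi (q : 'I_NB) : nat :=
  \sum_j bit2 (xi (inr (q, inr (j, false)))) (xi (inr (q, inr (j, true)))).

Definition Rsum xi : nat := \sum_q Rblock xi q.

Definition Psum xi : nat := \sum_q Rblock xi q * Yblock xi q.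

(* [(Rsum xi)./2] has the parity of the second binary digit of [Rsum xi]. *)
Definition phase (P S L : nat) : R[i] := 'i%R ^+ P * (-1) ^+ (S./2 * L).

Definition fxi xi : R[i] := phase (Psum xi) (Rsum xi) (Lsum xi).

Lemma norm_phase P S L : `|phase P S L| = 1.
Proof.
by rewrite normrM !normrX normrN1 normCi !expr1n mulr1.
Qed.

Lemma phase_t2 P S L : phase P S (L + 2)%N = phase P S L.
Proof.
rewrite /phase mulnDr exprD [(_ * 2)%N]mulnC [(-1) ^+ (2 * _)]exprM.
by rewrite sqrrN !expr1n mulr1.
Qed.

(** The factor i^(2 Y) = (-1)^L cancels the (-1)^L that comes from raising [S./2] by one, and only
    (-1)^t survives. *)
Lemma phase_s2 P S L Y t : odd Y = odd L ->
  phase (P + 2 * Y)%N (S + 2)%N (L + t)%N = (-1) ^+ t * phase P S (L + t)%N.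
Proof.
move=> oY; rewrite /phase exprD.
have -> : 'i%R ^+ (2 * Y) = (-1) ^+ L :> R[i].
  by rewrite exprM sqrCi -(signr_odd _ Y) oY signr_odd.
have -> : (S + 2)./2 = (S./2).+1 by rewrite addn2.
rewrite mulSn !exprD; have := sqrr_sign R[i] L.
by move: ('i%R ^+ P) ((-1) ^+ L) => u v; rewrite expr2 => vv; ring: vv.
Qed.

(** A letter collects the bits of one block at [x] (index 0) and at the [M] shifts, so that uniform
    [x] and shifts form uniform words whose positions are the blocks. *)
Definition SA : finType := {ffun 'I_M.+1 * (bool * bool) -> 'F_2}.
Definition SB : finType :=
  {ffun 'I_M.+1 * (bool * bool + 'I_M.+1 * bool) -> 'F_2}.
Implicit Types (A : {ffun 'I_NA -> SA}) (B : {ffun 'I_NB -> SB}).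

Definition entry A B (i : 'I_M.+1) (c : cell) : 'F_2 :=
  match c with inl (p, d) => A p (i, d) | inr (q, d) => B q (i, d) end.

Definition combi A B (a : 'I_M.+1 -> 'F_2) : cell -> 'F_2 :=
  fun c => \sum_i a i * entry A B i c.

(* What is planted in a block, as a table of bits indexed by [i <= M]: the row of
   [i = 0] goes into [x] and the other rows go into the shifts [h]. *)
Definition letterA (al : bool -> bool -> bool) : SA :=
  [ffun x => if x.1 == ord0 then (al x.2.1 x.2.2)%:R else 0].

(** At parameter [a], the two bits in the auxiliary slot [j] become [\sum_i a i * lam i j] and
    [a j], so that [Yblock] is modulo 2 the quadratic form of [lam] at [a]. *)
Definition letterB (be : bool -> bool -> bool) (lam : 'I_M.+1 -> 'I_M.+1 -> 'F_2)
    : SB :=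
  [ffun x => match x.2 with
    | inl (s, w) => if x.1 == ord0 then (be s w)%:R else 0
    | inr (j, w) => if w then (x.1 == j)%:R else lam x.1 j
    end].

(** The matrix of the quadratic form in [a] that gives [L] outside block [p] modulo 2. Since block
    [p] is left out, planting there does not change it. *)
Definition lambda A (p : 'I_NA) (i j : 'I_M.+1) : 'F_2 :=
  \sum_(p' | p' != p) \sum_s A p' (i, (s, false)) * A p' (j, (s, true)).

Definition count2 (al : bool -> bool -> bool) : nat :=
  (al false false && al false true) + (al true false && al true true).

Lemma F2_natr (a : 'F_2) : (a : nat)%:R = a.
Proof. exact: natr_Zp. Qed.

Lemma F2_odd (m n : nat) : m%:R = n%:R :> 'F_2 -> odd m = odd n.
Proof.
move=> /(congr1 (@nat_of_ord _)); rewrite !val_Fp_nat // !modn2.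
by case: (odd m) (odd n) => [] [].
Qed.

Lemma F2_ind (Q : 'F_2 -> Prop) : Q 0 -> Q 1 -> forall a, Q a.
Proof.
by move=> Q0 Q1 [[|[|//]] lt]; [rewrite (_ : Ordinal lt = 0)|
  rewrite (_ : Ordinal lt = 1)] => //; apply: val_inj.
Qed.

Lemma bit2_bool (b c : bool) : bit2 b%:R c%:R = (b && c).
Proof. by case: b c => [] []. Qed.

(* With [a 0 = 1], the number [Y] contributed by the planted block is congruent
   modulo 2 to [\sum_(i, j) a i * a j * lambda i j], the value of [L] outside
   block [p] at the point of parameter [a]. *)
Lemma planted_phase A B p q (a : 'I_M.+1 -> 'F_2) : a ord0 = 1 ->
  exists P S L Y : nat, odd Y = odd L /\ forall al be,
    fxi (combi (upd A p (letterA al)) (upd B q (letterB be (lambda A p))) a) =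
    phase (P + count2 be * Y)%N (S + count2 be)%N (L + count2 al)%N.
Proof.
move=> a0.
(* A row planted only at [i = 0] appears unchanged in every combination with [a 0 = 1]. *)
have first (F : 'I_M.+1 -> 'F_2) (y : 'F_2) :
    (forall i, F i = if i == ord0 then y else 0) -> \sum_i a i * F i = y.
  move=> FE; rewrite (bigD1 ord0) //= FE eqxx a0 mul1r big1 ?addr0 // => i i0.
  by rewrite FE (negPf i0) mulr0.
pose xi := combi A B a.
pose Y := (\sum_j bit2 (\sum_i a i * lambda A p i j)%R (a j))%N.
pose L := (\sum_(p' | p' != p)
  \sum_s bit2 (xi (inl (p', (s, false)))) (xi (inl (p', (s, true)))))%N.
exists (\sum_(q' | q' != q) Rblock xi q' * Yblock xi q')%N,
  (\sum_(q' | q' != q) Rblock xi q')%N, L, Y; split.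
  apply: F2_odd; rewrite /Y /L !natr_sum.
  transitivity (\sum_j \sum_i a i * lambda A p i j * a j).
    apply: eq_bigr => j _; rewrite natrM !F2_natr mulr_suml //.
  transitivity (\sum_(p' | p' != p) \sum_s
      xi (inl (p', (s, false))) * xi (inl (p', (s, true)))); last first.
    apply: eq_bigr => p' _; rewrite natr_sum; apply: eq_bigr => s _.
    by rewrite natrM !F2_natr.
  rewrite exchange_big /=.
  pose T i j p' s := (a i * A p' (i, (s, false))) * (a j * A p' (j, (s, true))).
  transitivity (\sum_i \sum_(p' | p' != p) \sum_j \sum_s T i j p' s).
    apply: eq_bigr => i _; rewrite exchange_big /=; apply: eq_bigr => j _.
    rewrite mulr_sumr mulr_suml; apply: eq_bigr => p' _.
    rewrite mulr_sumr mulr_suml; apply: eq_bigr => s _.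
    by rewrite /T [a j * _]mulrC !mulrA.
  rewrite exchange_big /=; apply: eq_bigr => p' _.
  transitivity (\sum_i \sum_s \sum_j T i j p' s).
    by apply: eq_bigr => i _; rewrite exchange_big.
  rewrite exchange_big /=; apply: eq_bigr => s _.
  by rewrite mulr_suml; apply: eq_bigr => i _; rewrite mulr_sumr.
move=> {}al {}be; set A' := upd _ _ _; set B' := upd _ _ _.
pose xi' := combi A' B' a; rewrite -/xi'.
have xiA p' d : p' != p -> xi' (inl (p', d)) = xi (inl (p', d)).
  by move=> /negPf pp; apply: eq_bigr => i _; rewrite /entry ffunE pp.
have xiB q' d : q' != q -> xi' (inr (q', d)) = xi (inr (q', d)).
  by move=> /negPf qq; apply: eq_bigr => i _; rewrite /entry ffunE qq.
have xip s w : xi' (inl (p, (s, w))) = (al s w)%:R.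
  by apply: first => i; rewrite /entry ffunE eqxx ffunE.
have xiq s w : xi' (inr (q, inl (s, w))) = (be s w)%:R.
  by apply: first => i; rewrite /entry ffunE eqxx ffunE.
have xiy j : xi' (inr (q, inr (j, false))) = \sum_i a i * lambda A p i j.
  by apply: eq_bigr => i _; rewrite /entry ffunE eqxx ffunE.
have xiz j : xi' (inr (q, inr (j, true))) = a j.
  rewrite /xi' /combi (bigD1 j) //= big1 => [|i /negPf ij].
    by rewrite ffunE eqxx ffunE /= eqxx mulr1 addr0.
  by rewrite ffunE eqxx ffunE /= ij mulr0.
have cnt (g : bool -> bool -> bool) :
    (\sum_s bit2 (g s false)%:R (g s true)%:R)%N = count2 g.
  by rewrite big_bool /= !bit2_bool addnC.
have Rq : Rblock xi' q = count2 be.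
  by rewrite -cnt; apply: eq_bigr => s _; rewrite !xiq.
have Rq' q' : q' != q -> Rblock xi' q' = Rblock xi q'.
  by move=> qq; apply: eq_bigr => s _; rewrite !xiB.
rewrite /fxi /Psum /Rsum /Lsum; congr phase.
- rewrite (bigD1 q) //= addnC Rq; congr (_ + _ * _)%N.
    apply: eq_bigr => q' qq; rewrite Rq' //; congr (_ * _)%N.
    by apply: eq_bigr => j _; rewrite !xiB.
  by apply: eq_bigr => j _; rewrite xiy xiz.
- by rewrite (bigD1 q) //= addnC Rq; congr (_ + _)%N; apply: eq_bigr.
- rewrite (bigD1 p) //= addnC; congr (_ + _)%N.
    by apply: eq_bigr => p' pp; apply: eq_bigr => s _; rewrite !xiA.
  by rewrite -cnt; apply: eq_bigr => s _; rewrite !xip.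
Qed.

End Construction.

(** * Lower bound for the Gowers norm of the counterexample *)

Lemma le_rootC (C : numClosedFieldType) n (x y : C) :
  (0 < n)%N -> 0 <= x -> x ^+ n <= y -> x <= n.-root y.
Proof.
by move=> n0 x0 xy; rewrite -[x](exprCK n0) // ler_rootCl // nnegrE exprn_ge0.
Qed.

Section GowersPhase.
Variable R : realType.

Definition psi (t : 'Z_4) : R[i] := 'i%R ^+ t.

Lemma psi_nat m : psi m%:R = 'i%R ^+ m.
Proof.
rewrite /psi val_Zp_nat // expr_mod // -[4%N]/(2 * 2)%N exprM sqrCi.
by rewrite sqrrN expr1n.
Qed.

Lemma psiD s t : psi (s + t) = psi s * psi t.
Proof. by rewrite -[s]natr_Zp -[t]natr_Zp -natrD !psi_nat exprD. Qed.

Lemma psi0 : psi 0 = 1.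
Proof. exact: expr0. Qed.

Lemma psiN t : psi (- t) = Num.conj (psi t).
Proof.
have n1 : psi t * Num.conj (psi t) = 1.
  by rewrite -normCK normrX normCi !expr1n.
by rewrite -[LHS]mulr1 -n1 mulrA -psiD addNr psi0 mul1r.
Qed.

(** A multiplicative derivative of [psi] composed with [P] is [psi] composed with [- fderiv h P],
    and [k] derivatives annihilate weight [k]. *)
Lemma gprod_psi (G : finZmodType) k (P : G -> 'Z_4) x (h : {ffun 'I_k -> G}) :
  wt k P -> gprod (fun y => psi (P y)) x h = 1.
Proof.
elim: k P x h => [|k IH] P x h; first by move=> /= P0; rewrite gprod0 P0 psi0.
move=> [Pk _]; rewrite gprodS -[RHS](IH _ x (ftail h) (wtN (Pk (h ord0)))).
by apply: eq_gprod => y; rewrite -psiN -psiD opprB.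
Qed.

Variables (M NA NB : nat).
Local Notation cells := (cell M NA NB).
Local Notation G := 'rV['F_2]_#|{: cells}|.

Definition point (x : G) : cells -> 'F_2 := fun c => x ord0 (enum_rank c).

Definition f0 (x : G) : R[i] := fxi R (point x).

Lemma pointD x y c : point (x + y) c = point x c + point y c.
Proof. by rewrite /point mxE. Qed.

Definition bitZ c (x : G) : 'Z_4 := (point x c : nat)%:R.

(** For bits |x + h| = |x| + |h| - 2 |x| |h|, so second derivatives modulo 4 are the constants 2
    |h1| |h2|. *)
Lemma wt_bitZ c : wt 3 (bitZ c).
Proof.
pose phi (a : 'F_2) : 'Z_4 := (a : nat)%:R.
split=> // h1; split=> // h2; split=> [h3 x|_ x]; rewrite /fderiv /bitZ !pointD.
  move: (point x c) (point h1 c) (point h2 c) (point h3 c).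
  by do 4!apply: F2_ind; apply/eqP.
move: (point x c) (point h1 c) (point h2 c).
by do 3!apply: F2_ind; apply/eqP.
Qed.

Lemma wt_bit2 c d : wt 4 (fun x => (bit2 (point x c) (point x d))%:R : 'Z_4).
Proof.
by apply: eq_wt (wtM (wt_bitZ c) (wt_bitZ d)) => x; rewrite natrM.
Qed.

Lemma wt_Psum : wt 6 (fun x => (Psum (point x))%:R : 'Z_4).
Proof.
apply: (@eq_wt _ _ (fun x => \sum_q ((Rblock (point x) q)%:R *
    (Yblock (point x) q)%:R : 'Z_4))).
  by move=> x; rewrite natr_sum; apply: eq_bigr => q _; rewrite natrM.
apply: wt_sum => q; apply: (@wtM _ 3 3).
  by apply: eq_wt (wt_sum _ _ (fun s => wt_bit2 _ _)) => x; rewrite natr_sum.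
by apply: eq_wt (wt_sum _ _ (fun s => wt_bit2 _ _)) => x; rewrite natr_sum.
Qed.

Lemma wt_Lsum : wt 6 (fun x => (Lsum (point x))%:R : 'Z_4).
Proof.
apply: (@wt_leq _ 4) => //.
apply: (@eq_wt _ _ (fun x => \sum_p (\sum_s bit2 (point x (inl (p, (s, false))))
    (point x (inl (p, (s, true)))))%N%:R : 'Z_4)).
  by move=> x; rewrite natr_sum.
apply: wt_sum => q.
by apply: eq_wt (wt_sum _ _ (fun s => wt_bit2 _ _)) => x; rewrite natr_sum.
Qed.

(** The function i^P (-1)^(j L) is a phase of weight 6, whose product over each 6-dimensional cube
    is 1; dividing [f0] by it leaves a sign. *)
Lemma gowers_f0 (j : bool) :
  avg (fun xh : G * {ffun 'I_6 -> G} => gprod f0 xh.1 xh.2) =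
  avg (fun xh : G * {ffun 'I_6 -> G} => gprod (fun x =>
    (-1) ^+ ((Rsum (point x))./2 * Lsum (point x) + j * Lsum (point x))%N : R[i])
      xh.1 xh.2).
Proof.
apply: eq_avg => -[x h] /=.
pose Q (x : G) : 'Z_4 := (Psum (point x))%:R + (Lsum (point x))%:R *+ (2 * j).
have Q6 : wt 6 Q.
  apply: wtD wt_Psum _; have L6 := wt_Lsum; case: (j) => /=.
    by apply: eq_wt (wtD L6 L6) => y; rewrite muln1 mulr2n.
  by apply: eq_wt (wt0 _ 6) => y; rewrite muln0 mulr0n.
rewrite -[RHS]mulr1 -[X in _ * X](gprod_psi x h Q6) -gprodM; apply: eq_gprod => y.
have iL : psi ((Lsum (point y))%:R *+ (2 * j)) = (-1) ^+ (j * Lsum (point y)).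
  by rewrite -[_ *+ (2 * j)]mulr_natr -natrM psi_nat mulnCA exprM sqrCi mulnC.
have := sqrr_sign R[i] (j * Lsum (point y)).
rewrite /Q psiD iL psi_nat /f0 /fxi /phase exprD expr2.
by move: ('i%R ^+ _) (_ ^+ (j * _)) (_ ^+ (_./2 * _)) => u v w vv; ring: vv.
Qed.

Hypothesis NA0 : (0 < NA)%N.

(* Flipping the two bits of one slot changes [Lsum] by the product of these bits,
   so one of four translates is even. *)
Lemma avg_even_ge :
  1 <= 4 * avg (fun x : G => (~~ odd (Lsum (point x)))%:R : R[i]).
Proof.
pose p0 := Ordinal NA0.
pose c w : cells := inl (p0, (false, w)).
pose e w : G := delta_mx ord0 (enum_rank (c w)).
pose ev (x : G) : R[i] := (~~ odd (Lsum (point x)))%:R.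
have shift k : avg (fun x => ev (x + k)) = avg ev.
  symmetry; apply: avg_reindex.
  by exists (fun x => x - k) => x; rewrite ?addrK ?subrK.
have -> : 4 * avg ev = avg (fun x => ev (x + 0) + ev (x + e false) +
    (ev (x + e true) + ev (x + (e false + e true)))).
  by rewrite !avgD !shift -!mulr2n -mulrnA mulr_natl.
have G0 : (0 < #|{: G}|)%N by apply/card_gt0P; exists 0.
rewrite -[leLHS](avg_const 1 G0); apply: ler_avg => x.
have pe w d : point (e w) d = (d == c w)%:R.
  by rewrite /point mxE eqxx (can_eq enum_rankK).
pose T (xi : cells -> 'F_2) (ps : 'I_NA * bool) :=
  bit2 (xi (inl (ps.1, (ps.2, false)))) (xi (inl (ps.1, (ps.2, true)))).
have Lsplit xi : Lsum xi =
    (bit2 (xi (c false)) (xi (c true)) + \sum_(ps | ps != (p0, false)) T xi ps)%N.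
  by rewrite /Lsum (pair_bigA _ (fun p s => T xi (p, s))) (bigD1 (p0, false)).
pose n := (\sum_(ps | ps != (p0, false)) T (point x) ps)%N.
have evE k : (forall d, d != c false -> d != c true -> point k d = 0) ->
    ev (x + k) = (~~ odd (bit2 (point x (c false) + point k (c false))
                               (point x (c true) + point k (c true)) + n))%:R.
  move=> k0; rewrite /ev Lsplit !pointD.
  congr (~~ odd (_ + _))%:R; apply: eq_bigr => -[p s] ps.
  have z w : point k (inl (p, (s, w))) = 0.
    by apply: k0; apply: contra ps => /eqP[-> -> _].
  by rewrite /T /= !pointD !z !addr0.
have e0 w d : d != c false -> d != c true -> point (e w) d = 0.
  by rewrite pe; case: w => /negPf d0 /negPf d1; rewrite ?d0 ?d1.
have z0 d : point 0 d = 0 by rewrite /point mxE.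
rewrite (evE 0) // (evE _ (e0 false)) (evE _ (e0 true)) evE; last first.
  by move=> d d0 d1; rewrite pointD !e0 // addr0.
rewrite !pointD !pe !z0.
have -> : (c false == c true) = false by [].
have -> : (c true == c false) = false by [].
rewrite !eqxx /point; move: (x _ _) (x _ _) => a b.
rewrite !(add0r, addr0) -!natrD ler1n !oddD.
by move: a b; case: (odd n); do 2!apply: F2_ind.
Qed.

(** The signs for the two values of [j] add up to twice the indicator of even [L], whose mean is at
    least 1/4. Hence one of the signs has mean at least 1/4 in absolute value, and [avg_gprod_ge]
    applies to it. *)
Lemma gowers_f0_ge : 4^-1 <= gowers_norm 6 f0.
Proof.
pose F (j : bool) (x : G) : R[i] :=
  (-1) ^+ ((Rsum (point x))./2 * Lsum (point x) + j * Lsum (point x))%N.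
have FF : avg (F false) + avg (F true) =
    2 * avg (fun x : G => (~~ odd (Lsum (point x)))%:R : R[i]).
  rewrite -avgD -avgZ; apply: eq_avg => x; rewrite /F mul0n mul1n addn0 exprD.
  rewrite -{1 2}signr_odd oddM -[in X in _ * X]signr_odd.
  by case: (odd (Lsum _)) => /=; rewrite ?andbF ?mulrN ?mulr1 ?subrr ?mulr0 -?mulr2n.
have [j Fj] : exists j, 4^-1 <= `|avg (F j)|.
  have r4 : (4^-1 : R[i]) \is Num.real by rewrite rpredV rpred_nat.
  case: (real_leP r4 (normr_real (avg (F false)))) => [|F0]; first by exists false.
  case: (real_leP r4 (normr_real (avg (F true)))) => [|F1]; first by exists true.
  have := le_lt_trans (ler_normD (avg (F false)) (avg (F true))) (ltrD F0 F1).
  have e0 : 0 <= avg (fun x : G => (~~ odd (Lsum (point x)))%:R : R[i]).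
    by apply: avg_ge0 => x; apply: ler0n.
  rewrite FF ger0_norm; last by apply: mulr_ge0; rewrite ?ler0n.
  rewrite -(ltr_pM2l (_ : 0 < 2)) ?ltr0n // mulrA -natrM.
  have -> : 2 * (4^-1 + 4^-1) = 1 :> R[i] by field.
  by move=> /(le_lt_trans avg_even_ge); rewrite ltxx.
have U6 : 4^-1 ^+ (2 ^ 6) <=
    avg (fun xh : G * {ffun 'I_6 -> G} => gprod f0 xh.1 xh.2).
  rewrite (gowers_f0 j); apply: le_trans (avg_gprod_ge 5 (F j)).
  by apply: lerXn2r; rewrite ?nnegrE ?invr_ge0 ?ler0n.
have q0 : 0 <= (4^-1 : R[i]) by rewrite invr_ge0 ler0n.
exact: le_rootC (expn_gt0 2 6) q0 U6.
Qed.

End GowersPhase.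

(** * Uniform points and shifts as words, and the planted cube *)

Section Sampling.
Variables (R : realType) (M NA NB : nat).
Local Notation cells := (cell M NA NB).
Local Notation G := 'rV['F_2]_#|{: cells}|.
Local Notation WA := {ffun 'I_NA -> SA M}.
Local Notation WB := {ffun 'I_NB -> SB M}.

Definition rowof (w : WA * WB) (i : 'I_M.+1) : G :=
  \row_k entry w.1 w.2 i (enum_val k).

Definition sample (w : WA * WB) : G * {ffun 'I_M -> G} :=
  (rowof w ord0, [ffun i => rowof w (lift ord0 i)]).

Lemma point_rowof w i c : point (rowof w i) c = entry w.1 w.2 i c.
Proof. by rewrite /point mxE enum_rankK. Qed.

Lemma point_eq (x y : G) : point x =1 point y -> x = y.
Proof.
move=> xy; apply/rowP=> k; have := xy (enum_val k).
by rewrite /point enum_valK.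
Qed.

Lemma sample_bij : bijective sample.
Proof.
pose inv (xh : G * {ffun 'I_M -> G}) : WA * WB :=
  let H := fcons xh.1 xh.2 in
  ([ffun p => [ffun d => point (H d.1) (inl (p, d.2))]],
   [ffun q => [ffun d => point (H d.1) (inr (q, d.2))]]).
have fs w : fcons (sample w).1 (sample w).2 = [ffun i => rowof w i].
  apply/ffunP=> i; rewrite [RHS]ffunE; case: (unliftP ord0 i) => [j|] ->.
    by rewrite fconsS ffunE.
  by rewrite fcons0.
exists inv.
  move=> w; rewrite /inv fs; case: w => A B; congr pair; apply/ffunP=> p;
  by rewrite ffunE; apply/ffunP=> -[i d]; rewrite !ffunE point_rowof.
move=> [x h].
have row_inv i : rowof (inv (x, h)) i = fcons x h i.
  by apply: point_eq => -[[p d]|[q d]]; rewrite point_rowof /= !ffunE.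
congr pair; first by rewrite row_inv fcons0.
by apply/ffunP=> i; rewrite ffunE row_inv fconsS.
Qed.

Lemma point_sample w (a : 'rV['F_2]_M) :
  point ((sample w).1 + dot a (sample w).2) =1
  combi w.1 w.2 (fun i => oapp (a ord0) 1 (unlift ord0 i)).
Proof.
move=> c; rewrite pointD point_rowof /combi big_ord_recl unlift_none mul1r.
congr (_ + _); rewrite /point /dot summxE; apply: eq_bigr => i _.
by rewrite liftK !mxE ffunE -point_rowof.
Qed.

Definition plant (w : WA * WB) (p : 'I_NA) (q : 'I_NB)
    (al be : bool -> bool -> bool) : WA * WB :=
  (upd w.1 p (letterA M al), upd w.2 q (letterB be (lambda w.1 p))).

(** The letter planted in the second word depends on the first word through [lambda]. The words are
    therefore treated in turn: once the first word and its position are fixed, that letter is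
    constant. *)
Lemma avg_sample_plant (phi : G * {ffun 'I_M -> G} -> R[i]) (C : R[i]) (D : nat)
    (al be : bool -> bool -> bool) :
  (0 < D)%N -> NA = (#|SA M| * D ^ 2)%N -> NB = (#|SB M| * D ^ 2)%N ->
  (forall xh, `|phi xh| <= C) ->
  `|avg phi - avg (fun u : (WA * 'I_NA) * (WB * 'I_NB) =>
      phi (sample (plant (u.1.1, u.2.1) u.1.2 u.2.2 al be)))| <= C *+ 2 / D%:R.
Proof.
move=> D0 cA cB phiC.
have C0 : 0 <= C by apply: le_trans (phiC (0, [ffun=> 0])).
rewrite (avg_reindex _ sample_bij).
rewrite (@eq_avg _ _ _ (fun w : WA * WB => phi (sample (w.1, w.2)))); last first.
  by case.
rewrite (avg_pair (fun A B => phi (sample (A, B)))).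
rewrite (avg_pair (fun (v : WA * 'I_NA) (z : WB * 'I_NB) =>
  phi (sample (plant (v.1, z.1) v.2 z.2 al be)))).
have t1 := avg_plant (letterA M al) D0 (etrans (card_ord _) cA)
  (fun A => avg_le_bound (fun B => phiC (sample (A, B))) C0).
have t2 v := avg_plant (letterB be (lambda v.1 v.2)) D0 (etrans (card_ord _) cB)
  (fun B => phiC (sample (upd v.1 v.2 (letterA M al), B))).
rewrite mulr2n mulrDl.
apply: le_trans (ler_distD _ _ _) (lerD t1 _).
rewrite -avgB; apply: avg_le_bound => [v|]; last by rewrite divr_ge0.
exact: t2.
Qed.

Definition flip (c : cells) : G := delta_mx ord0 (enum_rank c).

Lemma point_flip c d : point (flip c) d = (d == c)%:R.
Proof. by rewrite /point mxE eqxx (can_eq enum_rankK). Qed.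

Definition bits4 (a b c d : bool) : bool -> bool -> bool :=
  fun s w => if s then if w then d else c else if w then b else a.

(** The bits [al] and [be] enter row 0 only, that is, only [x]. *)
Lemma sample_plant2 w p q al be al' be' :
  (sample (plant w p q al be)).2 = (sample (plant w p q al' be')).2.
Proof.
apply/ffunP=> i; rewrite !ffunE; apply: point_eq => c; rewrite !point_rowof.
by case: c => -[r d]; rewrite /= !ffunE; case: eqP => // _; rewrite !ffunE.
Qed.

Lemma sample_plant1 w p q b1 b2 b3 b4 b5 b6 b7 b8 :
  (sample (plant w p q (bits4 b5 b6 b7 b8) (bits4 b1 b2 b3 b4))).1 =
  (sample (plant w p q (fun _ _ => false) (fun _ _ => false))).1
  + flip (inr (q, inl (false, false))) *+ b1
  + flip (inr (q, inl (false, true))) *+ b2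
  + flip (inr (q, inl (true, false))) *+ b3
  + flip (inr (q, inl (true, true))) *+ b4
  + flip (inl (p, (false, false))) *+ b5
  + flip (inl (p, (false, true))) *+ b6
  + flip (inl (p, (true, false))) *+ b7
  + flip (inl (p, (true, true))) *+ b8.
Proof.
have flipE c (b : bool) d : point (flip c *+ b) d = (b && (d == c))%:R.
  by case: b; rewrite ?mulr1n ?point_flip // mulr0n /point mxE.
have inlE r d p' d' : ((inl (r, d) : cells) == inl (p', d')) =
    (r == p') && (d == d') by [].
have inrE r d q' d' : ((inr (r, d) : cells) == inr (q', d')) =
    (r == q') && (d == d') by [].
have lrE x y : ((inl x : cells) == inr y) = false by [].
have rlE x y : ((inr x : cells) == inl y) = false by [].
apply: point_eq => c; rewrite !pointD !flipE !point_rowof.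
case: c => -[r d]; rewrite ?inlE ?inrE ?lrE ?rlE ?andbF ?addr0 /= !ffunE.
  case: eqP => [_|_] /=; last by rewrite ?andbF ?addr0.
  rewrite !ffunE /= add0r.
  by case: d => [[] []]; rewrite /= ?andbT ?andbF ?addr0 ?add0r.
case: eqP => [_|_] /=; last by rewrite ?andbF ?addr0.
rewrite !ffunE /=; case: d => [[[] []]|[j [] /=]].
all: by rewrite /= ?andbT ?andbF ?addr0 ?add0r.
Qed.

End Sampling.

(** * A quintic polynomial on the planted cube *)

Lemma eq_dd (Z : zmodType) (phi psi : bool -> bool -> Z) :
  (forall a b, phi a b = psi a b) -> dd phi = dd psi.
Proof. by move=> e; rewrite /dd !e. Qed.

Section Planted.
Variables (R : realType) (M NA NB : nat).
Local Notation cells := (cell M NA NB).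
Local Notation G := 'rV['F_2]_#|{: cells}|.

Lemma norm_f0 (x : G) : `|f0 R x| = 1.
Proof. exact: norm_phase. Qed.

Lemma f0_disk (x : G) : `|f0 R x| <= 1.
Proof. by rewrite norm_f0. Qed.

Definition fdisk (x : G) : disk R := exist _ (f0 R x) (f0_disk x).

Definition window (h : {ffun 'I_M -> G}) (x : G) : 'rV['F_2]_M -> disk R :=
  fun a => fdisk (x + dot a h).

Variables (w : {ffun 'I_NA -> SA M} * {ffun 'I_NB -> SB M})
  (p : 'I_NA) (q : 'I_NB).

Definition quad : finType := (bool * bool * bool * bool)%type.

Definition of_quad (u : quad) : bool -> bool -> bool :=
  let: (a, b, c, d) := u in bits4 a b c d.

Definition vertex (u : quad * quad) : G * {ffun 'I_M -> G} :=
  sample (plant w p q (of_quad u.2) (of_quad u.1)).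

Definition count4 (u : quad) : nat := count2 (of_quad u).

Lemma vertex2 u v : (vertex u).2 = (vertex v).2.
Proof. exact: sample_plant2. Qed.

(** Here [Phi] depends on [a] but its coincidences do not, so that they hold for whole windows at
    once. *)
Lemma f0_vertex (a : 'rV['F_2]_M) : exists Phi : nat -> nat -> R[i],
  [/\ forall u, f0 R ((vertex u).1 + dot a (vertex u).2) =
        Phi (count4 u.1) (count4 u.2),
      forall s, Phi s 2%N = Phi s 0%N &
      forall t, Phi 2%N t = (-1) ^+ t * Phi 0%N t].
Proof.
pose aa (i : 'I_M.+1) : 'F_2 := oapp (a ord0) 1 (unlift ord0 i).
have a0 : aa ord0 = 1 by rewrite /aa unlift_none.
have [P [S [L [Y [oY PhiE]]]]] := planted_phase R w.1 w.2 p q a0.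
exists (fun s t => phase R (P + s * Y)%N (S + s)%N (L + t)%N); split.
- move=> u; rewrite -PhiE /f0 /vertex.
  have -> : point ((sample (plant w p q (of_quad u.2) (of_quad u.1))).1 +
      dot a (sample (plant w p q (of_quad u.2) (of_quad u.1))).2) =
    combi (upd w.1 p (letterA M (of_quad u.2)))
          (upd w.2 q (letterB (of_quad u.1) (lambda w.1 p))) aa.
    by apply/funext => c; rewrite point_sample.
  by [].
- by move=> s; rewrite phase_t2 addn0.
- by move=> t; rewrite phase_s2 // mul0n !addn0.
Qed.

(* A vertex with window [(s, t)], up to the coincidences of [f0_vertex]. *)
Definition rep (s t : nat) : quad * quad :=
  let s2 := (s == 2) && (t == 1) in let s1 := (s == 1) || s2 in
  ((s1, s1, s2, s2), (t == 1, t == 1, false, false)).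

Lemma window_rep u :
  window (vertex u).2 (vertex u).1 =
  window (vertex u).2 (vertex (rep (count4 u.1) (count4 u.2))).1.
Proof.
apply/funext => a; apply: val_inj.
rewrite -[LHS]/(f0 R ((vertex u).1 + dot a (vertex u).2)).
pose u2 := rep (count4 u.1) (count4 u.2).
rewrite -[RHS]/(f0 R ((vertex u2).1 + dot a (vertex u).2)) {2}(vertex2 u u2) /u2.
have [Phi [PhiE t2 s2]] := f0_vertex a; rewrite !PhiE.
have le2 (v : quad) : (count4 v <= 2)%N by case: v => [[[[] []] []] []].
move: (count4 u.1) (le2 u.1) (count4 u.2) (le2 u.2) => s ls t lt.
case: s ls => [|[|[|//]]] _; case: t lt => [|[|[|//]]] _ //=;
  by rewrite /count4 /rep /= ?t2 ?s2 ?expr0 ?mul1r ?t2.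
Qed.

Lemma vertex1 (b1 b2 b3 b4 b5 b6 b7 b8 : bool) :
  (vertex ((b1, b2, b3, b4), (b5, b6, b7, b8))).1 =
  (sample (plant w p q (fun _ _ => false) (fun _ _ => false))).1
  + flip (inr (q, inl (false, false))) *+ b1
  + flip (inr (q, inl (false, true))) *+ b2
  + flip (inr (q, inl (true, false))) *+ b3
  + flip (inr (q, inl (true, true))) *+ b4
  + flip (inl (p, (false, false))) *+ b5
  + flip (inl (p, (false, true))) *+ b6
  + flip (inl (p, (true, false))) *+ b7
  + flip (inl (p, (true, true))) *+ b8.
Proof. exact: sample_plant1. Qed.

Lemma f0_vertex_opp : f0 R (vertex (rep 2 1)).1 = - f0 R (vertex (rep 0 1)).1.
Proof.
have [Phi [PhiE _ s2]] := f0_vertex 0.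
have d0 h : dot (0 : 'rV['F_2]_M) h = 0 :> G.
  by rewrite /dot big1 // => i _; rewrite mxE scale0r.
have := PhiE (rep 2 1); have := PhiE (rep 0 1); rewrite !d0 !addr0 => -> ->.
by rewrite /count4 /= s2 expr1 mulN1r.
Qed.

(** Vertices with equal windows share the value of [F], so [Pol] at a vertex is within twice the
    total error of its value at the representative. This doubles the factor 128 of [two_cubes], and
    the opposite values of [f0] turn the sum into a difference of values of [eT]. *)
Lemma planted_correlation (Pol : G -> torus R)
    (F : ('rV['F_2]_M -> disk R) -> R[i]) : is_poly 5 Pol ->
  `| f0 R (vertex (rep 2 1)).1 * eT (- Pol (vertex (rep 2 1)).1)
   + f0 R (vertex (rep 0 1)).1 * eT (- Pol (vertex (rep 0 1)).1)| <=
  (\sum_u `|eT (Pol (vertex u).1) - F (window (vertex u).2 (vertex u).1)|) *+ 256.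
Proof.
move=> Pol5; pose X u := (vertex u).1.
pose err u := `|eT (Pol (X u)) - F (window (vertex u).2 (X u))|.
rewrite -/(X _) -/(X _).
have -> : \sum_u `|eT (Pol (vertex u).1) - F (window (vertex u).2 (vertex u).1)|
    = \sum_u err u by [].
pose N (t : torus R) := `|eT t - 1|.
have ND s t : N (s + t) <= N s + N t.
  rewrite /N eTD (_ : eT s * eT t - 1 = (eT s - 1) + eT s * (eT t - 1)).
    by apply: le_trans (ler_normD _ _) _; rewrite normrM norm_eT mul1r.
  by ring.
have NN s : N (- s) = N s.
  by rewrite /N -[- s]sub0r -dist_eT eT0 distrC.
pose qq b1 b2 b3 b4 b5 b6 b7 b8 := Pol (X ((b1, b2, b3, b4), (b5, b6, b7, b8))).
pose r s t := Pol (X (rep s t)).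
have err_le u : err u <= \sum_u err u.
  by rewrite (bigD1 u) //= lerDl sumr_ge0 // => v _; apply: normr_ge0.
have close u : N (Pol (X u) - r (count4 u.1) (count4 u.2)) <= (\sum_u err u) *+ 2.
  rewrite /N -dist_eT mulr2n.
  apply: le_trans (ler_distD (F (window (vertex u).2 (X u))) _ _) _.
  apply: lerD; first exact: err_le.
  rewrite distrC window_rep.
  rewrite (vertex2 u (rep (count4 u.1) (count4 u.2))).
  exact: err_le (rep (count4 u.1) (count4 u.2)).
have q1 : dd (fun b1 b2 => dd (fun b3 b4 => dd (fun b5 b6 =>
    qq b1 b2 b3 b4 b5 b6 false false))) = 0.
  rewrite -(Pol5 [tuple flip (inr (q, inl (false, false)));
    flip (inr (q, inl (false, true))); flip (inr (q, inl (true, false)));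
    flip (inr (q, inl (true, true))); flip (inl (p, (false, false)));
    flip (inl (p, (false, true)))]
    (sample (plant w p q (fun _ _ => false) (fun _ _ => false))).1) /=.
  rewrite fderiv2; apply: eq_dd => b1 b2; rewrite fderiv2; apply: eq_dd => b3 b4.
  by rewrite fderiv2; apply: eq_dd => b5 b6; rewrite /qq /X vertex1 !addr0.
have q2 : dd (fun b1 b2 => dd (fun b5 b6 => dd (fun b7 b8 =>
    qq b1 b2 false false b5 b6 b7 b8))) = 0.
  rewrite -(Pol5 [tuple flip (inr (q, inl (false, false)));
    flip (inr (q, inl (false, true))); flip (inl (p, (false, false)));
    flip (inl (p, (false, true))); flip (inl (p, (true, false)));
    flip (inl (p, (true, true)))]
    (sample (plant w p q (fun _ _ => false) (fun _ _ => false))).1) /=.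
  rewrite fderiv2; apply: eq_dd => b1 b2; rewrite fderiv2; apply: eq_dd => b3 b4.
  by rewrite fderiv2; apply: eq_dd => b5 b6; rewrite /qq /X vertex1 !addr0.
(* The identifications hold by computation, since [rep] selects the same vertex. *)
have := two_cubes ND NN q1 q2 (erefl : r 0 2 = r 0 0) (erefl : r 1 2 = r 1 0)
  (erefl : r 2 0 = r 0 0) (fun b1 b2 b3 b4 b5 b6 b7 b8 =>
    close ((b1, b2, b3, b4), (b5, b6, b7, b8))).
rewrite -mulrnA; apply: le_trans.
rewrite f0_vertex_opp mulNr addrC -mulrBr normrM norm_f0 mul1r dist_eT opprK.
by rewrite [- _ + _]addrC lexx.
Qed.

End Planted.

(** * Transfer between planted and uniform points *)

Section Assembly.
Variables (R : realType) (M NA NB D : nat).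
Local Notation cells := (cell M NA NB).
Local Notation G := 'rV['F_2]_#|{: cells}|.
Local Notation Hs := {ffun 'I_M -> G}.
Hypotheses (D0 : (0 < D)%N) (cA : NA = (#|SA M| * D ^ 2)%N)
  (cB : NB = (#|SB M| * D ^ 2)%N).
Variables (kappa : Hs -> R[i]) (P : Hs -> G -> torus R)
  (F : Hs -> ('rV['F_2]_M -> disk R) -> R[i]).
Hypotheses (kappaM : forall h, `|kappa h| <= M%:R)
  (P5 : forall h, kappa h != 0 -> is_poly 5 (P h))
  (F2 : forall h u, `|F h u| <= 2).

(** With [kappa] the inverse of the correlation for successful [h] and 0 for the others, the average
    score becomes the probability of success. *)
Definition score (xh : G * Hs) : R[i] :=
  kappa xh.2 * (f0 R xh.1 * eT (- P xh.2 xh.1)).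

Definition defect (xh : G * Hs) : R[i] :=
  `|kappa xh.2| * `|eT (P xh.2 xh.1) - F xh.2 (window R xh.2 xh.1)|.

Lemma norm_score xh : `|score xh| <= M%:R.
Proof. by rewrite /score normrM normrM norm_f0 norm_eT !mulr1. Qed.

Lemma norm_defect xh : `|defect xh| <= M%:R * 3.
Proof.
rewrite /defect normrM !normr_id ler_pM ?normr_ge0 //.
apply: le_trans (ler_normB _ _) _; rewrite norm_eT.
by rewrite -[3]/(1 + 2)%:R natrD lerD2l.
Qed.

(** The two copies of the average are moved to the planted vertices [rep 2 1] and [rep 0 1], where
    the scores nearly cancel; the remaining defects at planted vertices are moved back to uniform
    points. *)
Lemma score_le :
  `|avg score + avg score| <=
  (\sum_(u : quad * quad) (avg defect + M%:R * 3 *+ 2 / D%:R)) *+ 256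
  + M%:R *+ 2 / D%:R *+ 2.
Proof.
pose O : finType := (({ffun 'I_NA -> SA M} * 'I_NA) *
  ({ffun 'I_NB -> SB M} * 'I_NB))%type.
pose V u (o : O) := vertex (o.1.1, o.2.1) o.1.2 o.2.2 u.
have tv (phi : G * Hs -> R[i]) C u : (forall xh, `|phi xh| <= C) ->
    `|avg phi - avg (fun o => phi (V u o))| <= C *+ 2 / D%:R.
  exact: avg_sample_plant.
pose u1 := rep 2 1; pose u0 := rep 0 1.
have -> : avg score + avg score = avg (fun o => score (V u1 o) + score (V u0 o))
    + ((avg score - avg (fun o => score (V u1 o))) +
       (avg score - avg (fun o => score (V u0 o)))).
  rewrite avgD; move: (avg score) (avg (fun o => score (V u1 o))).
  by move: (avg (fun o => score (V u0 o))) => a b c; ring.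
apply: le_trans (ler_normD _ _) _; apply: lerD; last first.
  rewrite mulr2n; apply: le_trans (ler_normD _ _) (lerD _ _);
  exact: tv norm_score.
apply: le_trans (ler_norm_avg _) _.
apply: (@le_trans _ _ (avg (fun o => (\sum_u defect (V u o)) *+ 256))).
  apply: ler_avg => o; rewrite /score /V.
  rewrite (vertex2 _ _ _ u1 u0) -mulrDr normrM.
  have [k0|k0] := eqVneq (kappa (vertex (o.1.1, o.2.1) o.1.2 o.2.2 u0).2) 0.
    rewrite k0 normr0 mul0r mulrn_wge0 // sumr_ge0 // => u _.
    by rewrite mulr_ge0.
  have -> : \sum_u defect (V u o) = `|kappa (V u0 o).2| *
      \sum_u `|eT (P (V u0 o).2 (V u o).1)
                - F (V u0 o).2 (window R (V u o).2 (V u o).1)|.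
    rewrite mulr_sumr; apply: eq_bigr => u _.
    by rewrite /defect /V (vertex2 _ _ _ u u0).
  rewrite -mulrnAr ler_wpM2l //; exact: planted_correlation (P5 k0).
rewrite (eq_avg (G := fun o => 256 * \sum_u defect (V u o))); last first.
  by move=> o; rewrite mulr_natl.
rewrite avgZ avg_sum -[leRHS]mulr_natl ler_wpM2l ?ler0n //.
apply: ler_sum => u _.
have d0 (h : O -> G * Hs) : 0 <= avg (fun o => defect (h o)).
  by apply: avg_ge0 => o; rewrite mulr_ge0.
rewrite -lerBlDl.
have : `|avg (fun o => defect (V u o)) - avg defect| <= M%:R * 3 *+ 2 / D%:R.
  by rewrite distrC; apply: tv norm_defect.
apply: le_trans; apply: real_ler_norm.
rewrite rpredB ?ger0_real ?d0 //.
by apply: avg_ge0 => o; rewrite mulr_ge0.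
Qed.

End Assembly.

(** * Choice of the constants and conclusion *)

Lemma realC_natV (R : realType) (a b : nat) :
  ((a%:R * b%:R)^-1)%:C = (a%:R * b%:R)^-1 :> R[i].
Proof. by rewrite fmorphV rmorphM !rmorph_nat. Qed.

Theorem theorem1p6 (R : realType) :
  ~ (forall (eta : R) (eps : nat -> R),
       0 < eta ->
       (forall m : nat, 0 < eps m) ->
       (forall m m' : nat, (m < m')%N -> eps m' < eps m) ->
       exists M : nat,
         forall (n : nat) (f : 'rV['F_2]_n -> disk R),
           eta%:C <= gowers_norm 6 (fun x => val (f x)) ->
           2^-1 <= prob R (fun h : {ffun 'I_M -> 'rV['F_2]_n} =>
             exists (m : nat) (P : 'rV['F_2]_n -> torus R)
                    (F : ('rV['F_2]_M -> disk R) -> R[i]),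
               [/\ (1 <= m <= M)%N,
                   is_poly 5 P,
                   lipschitz_eucl M%:R F,
                   m%:R^-1 <= `|avg (fun x => val (f x) * eT (- P x))| &
                   avg (fun x => `|eT (P x) - F (fun a => f (x + dot a h))|)
                     <= (eps m)%:C])).
Proof.
move=> H.
(* The factor of the average defect in [score_le]: 256 for each vertex. *)
pose K := (256 * #|{: quad * quad}|)%N.
have K0 : (0 < K)%N by rewrite muln_gt0 /=; apply/card_gt0P; exists (rep 0 0).
(* The defect carries a factor [kappa h] of size at most [m], and [m * eps m] is below 1 / (4 K). *)
pose eps (m : nat) : R := ((4 * K)%:R * m.+1%:R)^-1.
have K4 : (0 < 4 * K)%N by rewrite muln_gt0 K0.
have eps0 m : 0 < eps m by rewrite invr_gt0 mulr_gt0 ?ltr0n.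
have eps_dec m m' : (m < m')%N -> eps m' < eps m.
  move=> mm; rewrite ltf_pV2 ?posrE ?mulr_gt0 ?ltr0n //.
  by rewrite ltr_pM2l ?ltr_nat ?ltr0n.
have eta0 : 0 < 4^-1 :> R by rewrite invr_gt0 ltr0n.
have [M HM] := H 4^-1 eps eta0 eps0 eps_dec.
(* Keeps all planting errors together below or at 6 / 32. *)
pose D := (32 * K.+1 * M.+1)%N.
have D0 : (0 < D)%N by rewrite !muln_gt0.
pose NA := (#|SA M| * D ^ 2)%N; pose NB := (#|SB M| * D ^ 2)%N.
have NA0 : (0 < NA)%N.
  by rewrite muln_gt0 expn_gt0 D0 andbT; apply/card_gt0P; exists [ffun=> 0].
pose G : finType := 'rV['F_2]_#|{: cell M NA NB}|.
pose fd : G -> disk R := @fdisk R M NA NB.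
have gow : (4^-1)%:C <= gowers_norm 6 (fun x => val (fd x)).
  rewrite fmorphV rmorph_nat; exact: gowers_f0_ge.
have {HM gow} := HM _ fd gow.
set Q := (X in prob _ X) => probQ.
pose good h (t : nat * (G -> torus R) * (('rV['F_2]_M -> disk R) -> R[i])) :=
  [/\ (1 <= t.1.1 <= M)%N, is_poly 5 t.1.2,
      t.1.1%:R^-1 <= `|avg (fun x => val (fd x) * eT (- t.1.2 x))| &
      avg (fun x => `|eT (t.1.2 x) - t.2 (fun a => fd (x + dot a h))|)
                     <= (eps t.1.1)%:C].
have /choice[sel selP] : forall h, exists t, Q h -> good h t.
  move=> h; have [[m [P [F [mM P5 _ cor app]]]]|nQ] := pselect (Q h).
    by exists (m, P, F).
  by exists (0%N, fun=> 0, fun=> 0).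
pose m h := (sel h).1.1; pose P h := (sel h).1.2.
pose c h := avg (fun x => val (fd x) * eT (- P h x)).
pose kappa h : R[i] := if `[< Q h >] then (c h)^-1 else 0.
(* Truncation bounds [F] by 2. Where it acts, the old value has distance more than 1 from the unit
   circle and 0 has distance 1, so no error grows. *)
pose F h u : R[i] := if `|(sel h).2 u| <= 2 then (sel h).2 u else 0.
have kappam h : Q h -> `|kappa h| <= (m h)%:R.
  move=> qh; have [/andP[m1 _] _ cm _] := selP h qh.
  rewrite /kappa asboolT // normfV.
  have m0 : 0 < (m h)%:R :> R[i] by rewrite ltr0n.
  rewrite -[leRHS]invrK lef_pV2 // posrE ?invr_gt0 //.
  by apply: lt_le_trans cm; rewrite invr_gt0.
have kappaM h : `|kappa h| <= M%:R.
  have [qh|nq] := pselect (Q h); last by rewrite /kappa asboolF // normr0 ler0n.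
  have [/andP[_ mM] _ _ _] := selP h qh.
  by apply: le_trans (kappam h qh) _; rewrite ler_nat.
have kappaQ h : kappa h != 0 -> Q h.
  by rewrite /kappa; case: asboolP => // _; rewrite eqxx.
have P5 h : kappa h != 0 -> is_poly 5 (P h).
  by move=> /kappaQ /selP[].
have F2 h u : `|F h u| <= 2.
  by rewrite /F; case: ifP => // _; rewrite normr0 ler0n.
have avg_score : 2^-1 <= avg (score kappa P).
  rewrite /score (avg_pair (fun x h => kappa h * (f0 R x * eT (- P h x)))).
  rewrite avg_exchange (eq_avg (G := fun h => (`[< Q h >] : nat)%:R)); last first.
    move=> h; rewrite avgZ -/(c h) /kappa; case: asboolP => qh; last by rewrite mul0r.
    have [/andP[m1 _] _ cm _] := selP h qh.
    rewrite mulVf // -normr_gt0; apply: lt_le_trans cm.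
    by rewrite invr_gt0 ltr0n.
  have -> : avg (fun h => (`[< Q h >] : nat)%:R : R[i]) = (prob R Q)%:C.
    rewrite /avg /prob rmorphM fmorphV !rmorph_nat mulrC; congr (_ / _).
    rewrite -natr_sum; congr _%:R; rewrite -sum1_card [RHS]big_mkcond /=.
    by apply: eq_bigr => h _; rewrite inE; case: `[< _ >].
  have -> : 2^-1 = (2^-1 : R)%:C :> R[i] by rewrite fmorphV rmorph_nat.
  by rewrite lecR.
have avg_defect : avg (defect kappa P F) <= (4 * K)%:R^-1.
  rewrite /defect (avg_pair (fun x h =>
    `|kappa h| * `|eT (P h x) - F h (window R h x)|)) avg_exchange.
  have Hs0 : (0 < #|{: {ffun 'I_M -> G}}|)%N.
    by apply/card_gt0P; exists [ffun=> 0].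
  rewrite -[leRHS](avg_const _ Hs0); apply: ler_avg => h; rewrite avgZ.
  have [->|k0] := eqVneq (kappa h) 0.
    by rewrite normr0 mul0r invr_ge0 ler0n.
  have qh := kappaQ h k0; have [_ _ _ app] := selP h qh.
  have {}app : avg (fun x => `|eT (P h x) - F h (window R h x)|) <=
      (eps (m h))%:C.
    apply: le_trans app; apply: ler_avg => x; rewrite /F -/(P h x).
    rewrite -[fun a => _]/(window R h x).
    case: ifP => // /negP/negP; rewrite -real_ltNge ?normr_real ?realn // => F2'.
    rewrite subr0 norm_eT distrC; apply: le_trans (lerB_dist _ _).
    by rewrite norm_eT lerBrDr ltW.
  apply: le_trans (ler_pM (normr_ge0 _) _ (kappam h qh) app) _.
    by apply: avg_ge0 => x; apply: normr_ge0.
  rewrite realC_natV invfM mulrCA ger_pMr ?invr_gt0 ?ltr0n //.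
  by rewrite ler_pdivrMr ?ltr0n // mul1r ler_nat.
(* Twice the average score is at least 1, whereas the bound is at most 1/4 + 6/32 = 7/16. *)
have := score_le D0 (erefl NA) (erefl NB) kappaM P5 F2.
rewrite sumr_const -mulrnA mulnC -/K.
move: (avg (score _ _)) avg_score (avg (defect _ _ _)) avg_defect => S S2 E EK.
have [k kE] : exists k : R[i], k = K%:R by exists K%:R.
have [d dE] : exists d : R[i], d = M%:R / D%:R by exists (M%:R / D%:R).
have k0 : 0 < k by rewrite kE ltr0n.
have kd : (k + 1) * d <= 32^-1.
  have D0' : 0 < D%:R :> R[i] by rewrite ltr0n.
  rewrite dE mulrA ler_pdivrMr // kE natr1 -natrM.
  have -> : 32^-1 * D%:R = (K.+1 * M.+1)%:R :> R[i].
    by rewrite /D -mulnA natrM mulKf // pnatr_eq0.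
  by rewrite ler_nat leq_mul.
have S1 : 1 <= `|S + S|.
  have -> : 1 = 2^-1 + 2^-1 :> R[i] by field.
  have S0 : 0 <= S by apply: le_trans S2; rewrite invr_ge0 ler0n.
  by rewrite ger0_norm ?addr_ge0 ?lerD.
move=> /(le_trans S1).
have nzD : D%:R != 0 :> R[i] by rewrite pnatr_eq0 -lt0n.
have -> : (E + M%:R * 3 *+ 2 / D%:R) *+ K + M%:R *+ 2 / D%:R *+ 2 =
    E * k + (6 * k + 4) * d.
  by rewrite -[_ *+ K]mulr_natr -kE dE; field.
have Ek : E * k <= 4^-1.
  apply: le_trans (ler_wpM2r (ltW k0) EK) _.
  by rewrite natrM -kE invfM -mulrA mulVf ?mulr1 // gt_eqF.
have d0 : 0 <= d by rewrite dE divr_ge0 ?ler0n.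
have dk : (6 * k + 4) * d <= 6 * 32^-1.
  apply: (@le_trans _ _ (6 * ((k + 1) * d))).
    rewrite mulrA ler_wpM2r // mulrDr mulr1 lerD2l.
    by rewrite ler_nat.
  by rewrite ler_wpM2l ?ler0n.
move=> /le_trans /(_ (lerD Ek dk)).
have -> : 4^-1 + 6 * 32^-1 = 7%:R / 16%:R :> R[i] by field.
by rewrite ler_pdivlMr ?ltr0n // mul1r ler_nat.
Qed.
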